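(* Let $R$ be a commutative ring with identity, let $A\in M_{s\times s}(R)$ be non-singular, and let $C_1,\dots,C_s$ be linear codes of the same length over $R$ such that $[C_1\,\dots\,C_s]\,A=[C_1\,\dots\,C_s]$. Then: 1. $[C_1\,\dots\,C_s]\,A$ is self-orthogonal if and only if $C_1,\dots,C_s$ are all self-orthogonal. 2. $[C_1\,\dots\,C_s]\,A$ is self-dual if and only if $C_1,\dots,C_s$ are all self-dual.
   Context: $M_{s\times s}(R)$ is the set of $s\times s$ matrices over $R$; $A$ is non-singular (invertible) if $\det(A)$ is a unit of $R$. A linear code of length $m$ over $R$ is an $R$-submodule of $R^m$. With $\langle x,y\rangle=\sum_{k} x_ky_k$, the dual of a linear code $C\subseteq R^m$ is $C^\perp=\{x\in R^m : \langle x,c\rangle=0 \text{ for all } c\in C\}$; $C$ is self-orthogonal if $C\subseteq C^\perp$ and self-dual if $C=C^\perp$. For linear codes $C_1,\dots,C_s$ of length $m$ and $A=(a_{i,j})\in M_{s\times s}(R)$, the matrix-product code is $[C_1\,\dots\,C_s]\,A=\{(c_1\,\dots\,c_s)A : c_i\in C_i\}$, where $(c_1\,\dots\,c_s)$ is the $m\times s$ matrix whose $i$th column is $c_i$. It is viewed as a linear code of length $ms$ by identifying an $m\times s$ matrix with the concatenation of its columns. $[C_1\,\dots\,C_s]$ denotes $[C_1\,\dots\,C_s]\,I_s$, where $I_s$ is the identity matrix; its elements are the matrices $(c_1\,\dots\,c_s)$ with $c_i\in C_i$. *)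

(* Defs.v *)
(* MathComp, with the classical sets of MathComp-Analysis: over an infinite
   ring, membership in a code or in its dual need not be decidable. *)
From mathcomp Require Import all_boot all_algebra.
From mathcomp Require Import boolp classical_sets.

Set Implicit Arguments.
Unset Strict Implicit.
Unset Printing Implicit Defensive.

Import GRing.Theory.
Local Open Scope classical_set_scope.
Local Open Scope ring_scope.

(* [unitmx] would require a [comUnitRingType], which excludes the zero ring and
   demands a decidable unit predicate; [comPzRingType] is the type of all
   commutative rings with identity. *)
Definition nonsingular (R : comPzRingType) (s : nat) (A : 'M[R]_s) : Prop :=
  exists d : R, d * \det A = 1.

Definition linear_code (R : comPzRingType) (m : nat) (C : set 'rV[R]_m) : Prop :=
  GRing.submod_closed (mem C).

Definition inner (R : comPzRingType) (m : nat) (x y : 'rV[R]_m) : R :=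
  \sum_(k < m) x 0 k * y 0 k.

Definition dual_code (R : comPzRingType) (m : nat) (C : set 'rV[R]_m) :
    set 'rV[R]_m :=
  [set x | forall c, C c -> inner x c = 0].

Definition self_orthogonal (R : comPzRingType) (m : nat) (C : set 'rV[R]_m) :
    Prop :=
  C `<=` dual_code C.

Definition self_dual (R : comPzRingType) (m : nat) (C : set 'rV[R]_m) : Prop :=
  C = dual_code C.

(* Codewords are row vectors; here they become the columns of a matrix. *)
Definition words_mx (R : comPzRingType) (m s : nat) (c : 'I_s -> 'rV[R]_m) :
    'M[R]_(m, s) :=
  \matrix_(k < m, i < s) c i 0 k.

(* [mxvec] concatenates rows, hence the transposition. *)
Definition col_concat (R : comPzRingType) (m s : nat) (M : 'M[R]_(m, s)) :
    'rV[R]_(s * m) :=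
  mxvec M^T.

Definition mpcode (R : comPzRingType) (m s : nat)
    (C : 'I_s -> set 'rV[R]_m) (A : 'M[R]_s) : set 'rV[R]_(s * m) :=
  [set w | exists2 c : 'I_s -> 'rV[R]_m,
             (forall i, C i (c i)) & w = col_concat (words_mx c *m A)].

Lemma mpcode_linear (R : comPzRingType) (m s : nat)
    (C : 'I_s -> set 'rV[R]_m) (A : 'M[R]_s) :
  (forall i, linear_code (C i)) -> linear_code (mpcode C A).
Proof.
move=> linC; split=> [|a u v]; rewrite !inE.
  exists (fun=> 0) => [i|]; first by have [C0 _] := linC i; rewrite inE in C0.
  have -> : words_mx (fun=> 0) = 0 :> 'M[R]_(m, s).
    by apply/matrixP=> k i; rewrite !mxE.
  by rewrite /col_concat mul0mx trmx0 linear0.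
move=> [c Cc ->] [d Cd ->]; exists (fun i => a *: c i + d i) => [i|].
  by have [_ /(_ a (c i) (d i))] := linC i; rewrite !inE; apply.
have -> : words_mx (fun i => a *: c i + d i) = a *: words_mx c + words_mx d.
  by apply/matrixP=> k i; rewrite !mxE.
by rewrite /col_concat mulmxDl -scalemxAl !linearP.
Qed.

(* Main.v *)
(** Since [C_1 ... C_s] A = [C_1 ... C_s], only the identity matrix matters.
    The code [C_1 ... C_s] is the direct sum of the C_i placed in disjoint
    blocks of coordinates: its dual is the direct sum of the duals, and an
    inclusion of direct sums holds exactly when it holds blockwise. *)
Require Import Defs.
From mathcomp Require Import all_boot all_algebra.
From mathcomp Require Import boolp classical_sets.

Set Implicit Arguments.
Unset Strict Implicit.
Unset Printing Implicit Defensive.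

Import GRing.Theory.
Local Open Scope classical_set_scope.
Local Open Scope ring_scope.

Lemma linear_code0 (R : comPzRingType) (m : nat) (C : set 'rV[R]_m) :
  linear_code C -> C 0.
Proof. by case; rewrite inE. Qed.

Lemma inner0r (R : comPzRingType) (m : nat) (x : 'rV[R]_m) : inner x 0 = 0.
Proof. by rewrite /inner big1 // => k _; rewrite mxE mulr0. Qed.

Lemma inner0l (R : comPzRingType) (m : nat) (x : 'rV[R]_m) : inner 0 x = 0.
Proof. by rewrite /inner big1 // => k _; rewrite mxE mul0r. Qed.

Lemma dual_code0 (R : comPzRingType) (m : nat) (C : set 'rV[R]_m) :
  dual_code C 0.
Proof. by move=> c _; rewrite inner0l. Qed.

(** [vec_mx] undoes the concatenation, and multiplying by the identity mixes no columns, so the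
    words [c i] are forced: they are the blocks of [w]. *)
Lemma mpcode1P (R : comPzRingType) (m s : nat) (C : 'I_s -> set 'rV[R]_m)
    (w : 'rV[R]_(s * m)) :
  mpcode C 1%:M w <-> forall i, C i (row i (vec_mx w)).
Proof.
split=> [[c Cc ->] i | Cw].
  rewrite /col_concat mulmx1 mxvecK.
  suff -> : row i (words_mx c)^T = c i by [].
  by apply/rowP=> k; rewrite !mxE.
exists (fun i => row i (vec_mx w)) => //.
rewrite /col_concat mulmx1.
suff -> : (words_mx (fun i => row i (vec_mx w)))^T = vec_mx w.
  by rewrite vec_mxK.
by apply/matrixP=> i k; rewrite !mxE.
Qed.

Lemma inner_blocks (R : comPzRingType) (m s : nat) (x y : 'rV[R]_(s * m)) :
  inner x y = \sum_(i < s) inner (row i (vec_mx x)) (row i (vec_mx y)).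
Proof.
(* Coordinates of the long word correspond bijectively to pairs (block, position in the block). *)
rewrite /inner pair_bigA (reindex _ (curry_mxvec_bij s m)) /=.
by apply: eq_bigr => -[i k] _; rewrite !mxE.
Qed.

(** The embedding of the [i]-th summand; its values serve as test words that isolate one block. *)
Definition single_block (R : comPzRingType) (m s : nat) (i : 'I_s)
    (x : 'rV[R]_m) : 'rV[R]_(s * m) :=
  mxvec (\matrix_(j < s) (if j == i then x else 0)).

Lemma row_single_block (R : comPzRingType) (m s : nat) (i j : 'I_s)
    (x : 'rV[R]_m) :
  row j (vec_mx (single_block i x)) = if j == i then x else 0.
Proof. by rewrite mxvecK rowK. Qed.

Lemma mpcode1_single_block (R : comPzRingType) (m s : nat)
    (C : 'I_s -> set 'rV[R]_m) (i : 'I_s) (x : 'rV[R]_m) :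
  (forall j, C j 0) -> mpcode C 1%:M (single_block i x) <-> C i x.
Proof.
move=> C0; rewrite mpcode1P; split=> [/(_ i) | Cx j].
  by rewrite row_single_block eqxx.
by rewrite row_single_block; case: eqP => [->|].
Qed.

Lemma inner_single_block (R : comPzRingType) (m s : nat) (i : 'I_s)
    (w : 'rV[R]_(s * m)) (x : 'rV[R]_m) :
  inner w (single_block i x) = inner (row i (vec_mx w)) x.
Proof.
rewrite inner_blocks (bigD1 i) //= row_single_block eqxx big1 ?addr0 // => j.
by move=> /negPf jNi; rewrite row_single_block jNi inner0r.
Qed.

(** Each [C i] contains 0, so single-block words are codewords, and orthogonality to them constrains
    each block separately. Conversely, the inner product vanishes block by block. *)
Lemma dual_mpcode1 (R : comPzRingType) (m s : nat)
    (C : 'I_s -> set 'rV[R]_m) :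
  (forall i, C i 0) ->
  dual_code (mpcode C 1%:M) = mpcode (fun i => dual_code (C i)) 1%:M.
Proof.
move=> C0; apply/seteqP; split=> w.
  move=> dw; apply/mpcode1P => i c Cc; rewrite -inner_single_block.
  by apply: dw; apply/mpcode1_single_block.
move=> /mpcode1P dw c /mpcode1P Cc; rewrite inner_blocks big1 // => i _.
exact: dw.
Qed.

(** Containing 0 matters: one empty [C i] would empty the whole product and make its inclusion say
    nothing about the other blocks. *)
Lemma mpcode1_subset (R : comPzRingType) (m s : nat)
    (C D : 'I_s -> set 'rV[R]_m) :
  (forall i, C i 0) -> (forall i, D i 0) ->
  mpcode C 1%:M `<=` mpcode D 1%:M <-> forall i, C i `<=` D i.
Proof.
move=> C0 D0; split=> [CD i x Cx | CD w /mpcode1P Cw].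
  by apply/(mpcode1_single_block i x D0)/CD/mpcode1_single_block.
by apply/mpcode1P => i; apply: CD.
Qed.

Theorem theorem3p7 (R : comPzRingType) (s m : nat) (A : 'M[R]_s)
    (C : 'I_s -> set 'rV[R]_m) :
  nonsingular A ->
  (forall i : 'I_s, linear_code (C i)) ->
  mpcode C A = mpcode C 1%:M ->
  (self_orthogonal (mpcode C A) <-> forall i : 'I_s, self_orthogonal (C i)) /\
  (self_dual (mpcode C A) <-> forall i : 'I_s, self_dual (C i)).
Proof.
move=> _ linC ->.
have C0 i : C i 0 by apply: linear_code0.
have D0 i : dual_code (C i) 0 by apply: dual_code0.
rewrite /self_orthogonal /self_dual dual_mpcode1 //.
split; first exact: mpcode1_subset.
(* Equality is split into two inclusions, each of which descends to the blocks because the codes and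
   their duals all contain 0. *)
split=> [/seteqP[/(mpcode1_subset C0 D0) CD /(mpcode1_subset D0 C0) DC] i | CD].
  by apply/seteqP.
by apply/seteqP; split; apply/mpcode1_subset => // i; rewrite -CD.
Qed.
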